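(* Let $n$ be a natural number and let $\mathcal{L}$ be a tree language. Suppose that (I) $\mathfrak{T}$ and $\mathfrak{S}$ are focal well-founded $\mathcal{L}$-trees; (II) $a_1,a_2\in T$ with $a_1<_{\mathfrak{T}}a_2$, and $b_1,b_2\in S$ with $b_1<_{\mathfrak{S}}b_2$; (III) $(\mathfrak{T};a_1)\equiv^{n+2}(\mathfrak{S};b_1)$ and $(\mathfrak{T};a_2)\equiv^{n+2}(\mathfrak{S};b_2)$; (IV) for some set $M$ of positive integers, (i) $(a_1,a_2)$ can be partitioned into $2^n-1$ subintervals, each of which is an $(n+1,M)$-block, and (ii) $(b_1,b_2)$ can be partitioned into $2^n-1$ subintervals, each of which is an $(n+1,M)$-block. Then $\left(\mathfrak{T}_{\mathsf{cs}}^{(a_1,a_2)};(a_1,a_2)\right)\equiv^n\left(\mathfrak{S}_{\mathsf{cs}}^{(b_1,b_2)};(b_1,b_2)\right)$.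
   Context: A tree is a structure $\mathfrak{T}=(T;<)$ with $T$ non-empty and $<$ a strict partial order that is downwards linear (each set $\{x : x \leqslant t\}$ is totally ordered) and downwards connected (for all $s,t$ there is $x$ with $x\leqslant s$ and $x\leqslant t$). A tree language $\mathcal{L}$ contains $=$, $<$ and finitely many constants and unary predicates; an $\mathcal{L}$-tree is a tree in this language, and $\mathcal{L}(\mathfrak{T})$ is the language of $\mathfrak{T}$. Elements of $T$ are called nodes. $(a,b)=\{x : a<x<b\}$; write $x\smile y$ if $x<y$, $y<x$ or $x=y$. $(\mathfrak{T};\bar a)$ and $(\mathfrak{T};A)$ denote expansions by constants $\bar a$ and by a unary predicate $A$. $\equiv^n$ denotes agreement on all first-order sentences of quantifier rank at most $n$. Natural numbers include $0$. Well-founded: every non-empty set of nodes has a minimal element. Focal: for each node $a$ and each $\mathcal{L}(\mathfrak{T})$-formula $\varphi(x,y)$, if there is $b\geqslant a$ with $\mathfrak{T}\models\varphi(a,b)$, then for each $c\geqslant a$ there is $d\geqslant a$ with $d\smile c$ and $\mathfrak{T}\models\varphi(a,d)$. $\tau^n_1(x),\ldots,\tau^n_m(x)$ is the (fixed, finite, up to logical equivalence) list of $n$-characteristic $\mathcal{L}$-formulas in one free variable: formulas of quantifier rank $n$ such that each element of each $\mathcal{L}$-structure satisfies exactly one of them, and $a$ in $\mathfrak{A}$ and $b$ in $\mathfrak{B}$ satisfy the same one iff $(\mathfrak{A};a)\equiv^n(\mathfrak{B};b)$. A set $X\subseteq T$ is an $(n,M)$-block (in $\mathfrak{T}$) if $\{i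 : \mathfrak{T}\models\tau^n_i(t)\text{ for some }t\in X\}=M$. Subintervals are convex subsets of the linear order in question. The co-forest of $a\in T$ has underlying set $T_{\mathsf{cf}}^{a}=\{x\in T : a\not<x \text{ and } y<x \text{ for all } y<a\}$. For $a<b$ the open cross section $\mathfrak{T}_{\mathsf{cs}}^{(a,b)}$ is the restriction of $\mathfrak{T}$ to $T_{\mathsf{cs}}^{(a,b)}=\bigcup_{x\in(a,b)}T_{\mathsf{cf}}^{x}$, which for well-founded trees equals $\{x\in T : a<x,\ b\not<x,\ x\notin T_{\mathsf{cf}}^{b}\}$. When a tree is restricted to a subset, constants of the language lying outside the subset are dropped; $n$-equivalence of two restrictions includes that the same constants are retained in both. *)

(* Defs.v *)
From HB Require Import structures.
From mathcomp Require Import all_boot.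
From mathcomp Require Import boolp classical_sets.

Set Implicit Arguments.
Unset Strict Implicit.
Unset Printing Implicit Defensive.

Local Open Scope classical_set_scope.

(* A tree language is given by its non-logical symbols other than [<]. *)
Record language := Language { cst : finType; prd : finType }.

Definition add_cst (L : language) : language := Language (option (cst L)) (prd L).
Definition add_prd (L : language) : language := Language (cst L) (option (prd L)).
Definition sublang (L : language) (D : {set cst L}) : language :=
  Language {c : cst L | c \in D} (prd L).

(* The carrier may be empty: open cross sections can be. *)
Record structure (L : language) := Structure {
  carrier :> Type;
  slt : carrier -> carrier -> Prop;
  scst : cst L -> carrier;
  sprd : prd L -> set carrier
}.

(* Well-scoped first-order syntax: the free variables of [phi : formula L k]
   are among 0, ..., k - 1; a quantifier binds variable 0 of its body and
   shifts the others by one.  The missing connectives and the existential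
   quantifier are the usual classical abbreviations. *)
Inductive term (L : language) (k : nat) : Type :=
| Var of 'I_k
| Cst of cst L.

Inductive formula (L : language) : nat -> Type :=
| Bot k : formula L k
| Eq k of term L k & term L k : formula L k
| Lt k of term L k & term L k : formula L k
| Prd k of prd L & term L k : formula L k
| Imp k of formula L k & formula L k : formula L k
| All k of formula L k.+1 : formula L k.

Fixpoint qrank (L : language) (k : nat) (phi : formula L k) : nat :=
  match phi with
  | Imp _ phi1 phi2 => maxn (qrank phi1) (qrank phi2)
  | All _ phi1 => (qrank phi1).+1
  | _ => 0
  end.

Definition eval (L : language) (A : structure L) (k : nat) (e : k.-tuple A)
    (t : term L k) : A :=
  match t with
  | Var i => tnth e i
  | Cst c => scst A c
  end.

Fixpoint sat (L : language) (A : structure L) (k : nat) (phi : formula L k) :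
    k.-tuple A -> Prop :=
  match phi with
  | Bot _ => fun _ => False
  | Eq _ t u => fun e => eval e t = eval e u
  | Lt _ t u => fun e => slt (eval e t) (eval e u)
  | Prd _ p t => fun e => sprd p (eval e t)
  | Imp _ phi1 phi2 => fun e => sat phi1 e -> sat phi2 e
  | All _ phi1 => fun e => forall a : A, sat phi1 [tuple of a :: e]
  end.

Definition equivn (L : language) (n : nat) (A B : structure L) : Prop :=
  forall phi : formula L 0, qrank phi <= n ->
    (sat phi ([tuple] : 0.-tuple A) <-> sat phi ([tuple] : 0.-tuple B)).

Definition expand_cst (L : language) (A : structure L) (a : A) :
    structure (add_cst L) :=
  @Structure (add_cst L) A (@slt L A) (fun c => oapp (scst A) a c) (@sprd L A).

Definition expand_prd (L : language) (A : structure L) (X : set A) :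
    structure (add_prd L) :=
  @Structure (add_prd L) A (@slt L A) (scst A) (fun p => oapp (@sprd L A) X p).

(* [D] is the set of constants that survive in the restriction to [X]. *)
Definition retained (L : language) (A : structure L) (X : set A)
    (D : {set cst L}) : Prop :=
  forall c : cst L, c \in D <-> X (scst A c).

Definition restriction (L : language) (A : structure L) (X : set A)
    (D : {set cst L}) (hD : retained X D) : structure (sublang D) :=
  @Structure (sublang D) {x : A | X x}
    (fun x y => slt (sval x) (sval y))
    (fun c => exist X (scst A (sval c)) (proj1 (hD (sval c)) (svalP c)))
    (fun p => [set x : {x : A | X x} | @sprd L A p (sval x)]).

Section Trees.
Context {L : language} {T : structure L}.

Definition sle (x y : T) : Prop := slt x y \/ x = y.

Definition comparable (x y : T) : Prop := [\/ slt x y, slt y x | x = y].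

Definition interval (a b : T) : set T := [set x | slt a x /\ slt x b].

Definition coforest (a : T) : set T :=
  [set x | ~ slt a x /\ forall y, slt y a -> slt y x].

Definition cross_section (a b : T) : set T :=
  \bigcup_(x in interval a b) coforest x.

Definition subinterval (I X : set T) : Prop :=
  X `<=` I /\
  forall x y z, X x -> X z -> I y -> slt x y -> slt y z -> X y.

End Trees.

Definition is_tree (L : language) (T : structure L) : Prop :=
  [/\ inhabited T,
      forall x : T, ~ slt x x,
      forall x y z : T, slt x y -> slt y z -> slt x z,
      forall t x y : T, sle x t -> sle y t -> comparable x y
    & forall s t : T, exists x : T, sle x s /\ sle x t].

Definition well_founded_tree (L : language) (T : structure L) : Prop :=
  forall X : set T, X !=set0 -> exists2 m, X m & forall x, X x -> ~ slt x m.

Definition focal (L : language) (T : structure L) : Prop :=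
  forall (a : T) (phi : formula L 2),
    (exists2 b, sle a b & sat phi [tuple a; b]) ->
    forall c, sle a c ->
      exists d, [/\ sle a d, comparable d c & sat phi [tuple a; d]].

(* [tau] lists the [n]-characteristic formulas in one free variable. *)
Definition characteristic (L : language) (n m : nat)
    (tau : 'I_m -> formula L 1) : Prop :=
  [/\ forall i, qrank (tau i) = n,
      forall (A : structure L) (a : A), exists! i, sat (tau i) [tuple a]
    & forall (A B : structure L) (a : A) (b : B),
        (forall i, sat (tau i) [tuple a] <-> sat (tau i) [tuple b]) <->
        equivn n (expand_cst a) (expand_cst b)].

(* The list of characteristic formulas is numbered from 1. *)
Definition block (L : language) (T : structure L) (m : nat)
    (tau : 'I_m -> formula L 1) (M : set nat) (X : set T) : Prop :=
  [set (nat_of_ord i).+1 | i in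
     [set i : 'I_m | exists2 t, X t & sat (tau i) [tuple t]]] = M.

(* The parts may be empty, which matters only when [M] is empty: otherwise
   blocks are non-empty. *)
Definition block_partition (L : language) (T : structure L) (m : nat)
    (tau : 'I_m -> formula L 1) (M : set nat) (k : nat) (I : set T) : Prop :=
  exists P : 'I_k -> set T,
    [/\ \bigcup_i P i = I,
        trivIset setT P,
        forall i, subinterval I (P i)
      & forall i, block tau M (P i)].

(* Main.v *)
(* In a well-founded tree the open cross section over (a, b) is the ordered sum
   of the co-forests of the nodes of (a, b).  Hence, after Spoiler moves in the
   co-forest of x, it suffices to find y in the other interval such that x and y
   have the same (n+1)-type in their trees and the two remaining cross sections
   on either side are (n-1)-equivalent.  A node x of the first tree leaves
   2^(n-1) - 1 blocks on at least one of its sides, say above it.  The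
   hypothesis on the lower end points, with focality, yields y comparable with
   the upper end point b2 such that the cross sections over (a1, x) and (b1, y)
   are equivalent.  If y leaves too few blocks above it, or lies outside
   (b1, b2), then (b1, y) contains many blocks, so by induction, applied to one
   and the same tree, y may be replaced by a node of the middle block of
   (b1, b2) having the type of x.  For the induction only the presence of
   sufficiently many disjoint blocks matters, not that they cover the
   interval. *)

Require Import Defs.
From HB Require Import structures.
From mathcomp Require Import all_boot.
From mathcomp Require Import boolp classical_sets.

Set Implicit Arguments.
Unset Strict Implicit.
Unset Printing Implicit Defensive.

Local Open Scope classical_set_scope.

(** * Ehrenfeucht-Fraisse games *)

Definition add_move (A B : Type) (P : A -> B -> Prop) (a : A) (b : B) :
    A -> B -> Prop :=
  fun u v => P u v \/ (u = a /\ v = b).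

Definition partial_iso (A B : Type) (ltA : A -> A -> Prop) (ltB : B -> B -> Prop)
    (X : set A) (Y : set B) (C P : A -> B -> Prop) : Prop :=
  forall u v, P u v -> [/\ X u, Y v, C u v &
    forall u' v', P u' v' -> (u = u' <-> v = v') /\ (ltA u u' <-> ltB v v')].

(* Duplicator wins the [r]-round Ehrenfeucht-Fraisse game between the suborders
   [X] and [Y] from the position [P]; the constants of the language are part of
   [P], and [C] says which nodes satisfy the same unary predicates. *)
Fixpoint bf (A B : Type) (ltA : A -> A -> Prop) (ltB : B -> B -> Prop)
    (X : set A) (Y : set B) (C : A -> B -> Prop) (r : nat) (P : A -> B -> Prop) :
    Prop :=
  match r with
  | 0 => partial_iso ltA ltB X Y C P
  | r'.+1 => (forall a, X a -> exists b, bf ltA ltB X Y C r' (add_move P a b)) /\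
             (forall b, Y b -> exists a, bf ltA ltB X Y C r' (add_move P a b))
  end.

Lemma add_move_sub (A B : Type) (P P' : A -> B -> Prop) (a : A) (b : B) :
  (forall u v, P' u v -> P u v) ->
  forall u v, add_move P' a b u v -> add_move P a b u v.
Proof. by move=> sub u v [/sub|]; [left|right]. Qed.

Section Game.
Context {A B : Type} {ltA : A -> A -> Prop} {ltB : B -> B -> Prop}.

Lemma bf_mono (X : set A) (Y : set B) (C C' P P' : A -> B -> Prop) (r : nat) :
  (forall u v, X u -> Y v -> C u v -> C' u v) ->
  (forall u v, P' u v -> P u v) ->
  bf ltA ltB X Y C r P -> bf ltA ltB X Y C' r P'.
Proof.
move=> subC; elim: r P P' => [|r IH] P P' sub /=.
  move=> h u v /sub/h[Xu Yv Cuv hP]; split=> //; first exact: subC.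
  by move=> u' v' /sub/hP.
case=> forth back; split=> [a /forth|b /back] [c hc]; exists c;
  exact: IH (add_move_sub sub) hc.
Qed.

Lemma bf_sub (X : set A) (Y : set B) (C P P' : A -> B -> Prop) (r : nat) :
  (forall u v, P' u v -> P u v) ->
  bf ltA ltB X Y C r P -> bf ltA ltB X Y C r P'.
Proof. exact: bf_mono. Qed.

Lemma bfS (X : set A) (Y : set B) (C P : A -> B -> Prop) (r : nat) :
  (forall u v, P u v -> X u \/ Y v) ->
  bf ltA ltB X Y C r.+1 P -> bf ltA ltB X Y C r P.
Proof.
elim: r P => [|r IH] P XY.
  move=> [forth back] u v Puv.
  have [Q PQ h] : exists2 Q : A -> B -> Prop, (forall u v, P u v -> Q u v) &
      partial_iso ltA ltB X Y C Q.
    case: (XY _ _ Puv) => [/forth|/back] [w hw].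
      by exists (add_move P u w) => //; left.
    by exists (add_move P w v) => //; left.
  case: (h u v (PQ _ _ Puv)) => Xu Yv Cuv hP; split=> // u' v' /PQ; exact: hP.
move=> [forth back]; split=> [a Xa|b Yb].
  case: (forth a Xa) => b hb; exists b; apply: IH hb => u v [/XY //|[-> _]].
  by left.
case: (back b Yb) => a ha; exists a; apply: IH ha => u v [/XY //|[_ ->]].
by right.
Qed.

Lemma bf_le (X : set A) (Y : set B) (C P : A -> B -> Prop) (r s : nat) :
  (forall u v, P u v -> X u \/ Y v) -> r <= s ->
  bf ltA ltB X Y C s P -> bf ltA ltB X Y C r P.
Proof.
move=> XY; elim: s => [|s IH]; first by rewrite leqn0 => /eqP->.
rewrite leq_eqVlt => /predU1P[-> //|]; rewrite ltnS => /IH h /(bfS XY); exact: h.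
Qed.

Lemma bf_iso (X : set A) (Y : set B) (C P : A -> B -> Prop) (r : nat) :
  (forall u v, P u v -> X u \/ Y v) ->
  bf ltA ltB X Y C r P -> partial_iso ltA ltB X Y C P.
Proof. by move=> XY; apply: (bf_le (r := 0)). Qed.

Lemma bf_last (X : set A) (Y : set B) (C P : A -> B -> Prop) (r : nat)
    (a : A) (b : B) :
  (forall u v, P u v -> X u \/ Y v) -> X a \/ Y b ->
  bf ltA ltB X Y C r (add_move P a b) -> X a /\ Y b.
Proof.
move=> XY Xab h.
have XY' u v : add_move P a b u v -> X u \/ Y v by case=> [/XY|[-> ->]].
by have [] := bf_iso XY' h (or_intror (conj erefl erefl)).
Qed.

Lemma bf_forth (X : set A) (Y : set B) (C P : A -> B -> Prop) (r : nat) (a : A) :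
  X a -> bf ltA ltB X Y C r.+1 P -> exists b, bf ltA ltB X Y C r (add_move P a b).
Proof. by move=> Xa [forth _]; apply: forth. Qed.

Lemma bf_back (X : set A) (Y : set B) (C P : A -> B -> Prop) (r : nat) (b : B) :
  Y b -> bf ltA ltB X Y C r.+1 P -> exists a, bf ltA ltB X Y C r (add_move P a b).
Proof. by move=> Yb [_ back]; apply: back. Qed.

Lemma bf_sym (X : set A) (Y : set B) (C P : A -> B -> Prop)
    (C' P' : B -> A -> Prop) (r : nat) :
  (forall u v, C u v -> C' v u) -> (forall u v, P' v u -> P u v) ->
  bf ltA ltB X Y C r P -> bf ltB ltA Y X C' r P'.
Proof.
move=> CC'; elim: r P P' => [|r IH] P P' PP' /=.
  move=> h v u /PP'/h[Xu Yv Cuv hP]; split=> //; first exact: CC'.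
  by move=> v' u' /PP'/hP[-> ->].
have add a b : forall u v, add_move P' b a v u -> add_move P a b u v.
  by move=> u v [/PP'|[-> ->]]; [left|right].
by case=> forth back; split=> [b /back|a /forth] [c hc]; exists c;
  apply: IH hc; apply: add.
Qed.

Lemma bf_refl (X : set A) (C P : A -> A -> Prop) (r : nat) :
  (forall u, C u u) -> (forall u v, P u v -> X u /\ u = v) ->
  bf ltA ltA X X C r P.
Proof.
move=> Crefl; elim: r P => [|r IH] P hP /=.
  move=> u v /hP[Xu <-]; split=> // u' v' /hP[_ <-] //.
by split=> a Xa; exists a; apply: IH => u v [/hP //|[-> ->]].
Qed.

(** The extra round of the game on the whole structures is saved for the end, where [guard] spends
    it on checking membership of [X] and [Y] and the condition [C']. [P0] holds the parameters from
    which these are defined. *)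
Lemma bf_relativize (X : set A) (Y : set B) (C C' P0 P : A -> B -> Prop)
    (r : nat) :
  (forall Q, (forall u v, P0 u v -> Q u v) -> bf ltA ltB setT setT C 1 Q ->
     forall u v, Q u v -> (X u <-> Y v) /\ C' u v) ->
  (forall u v, P0 u v -> P u v) ->
  bf ltA ltB setT setT C r.+1 P ->
  bf ltA ltB X Y C' r (fun u v => P u v /\ (X u \/ Y v)).
Proof.
move=> guard; elim: r P => [|r IH] P P0P h.
  have hP := bf_iso (fun u v _ => or_introl I) h.
  move=> u v [Puv Xuv]; have [XY Cuv] := guard _ P0P h u v Puv.
  have Xu : X u by case: Xuv => // /XY.
  split=> //; first exact/XY.
  by move=> u' v' [Pu'v' _]; have [_ _ _] := hP _ _ Puv; apply.
have add a b : forall u v, P0 u v -> add_move P a b u v by left; apply: P0P.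
have lift a b : bf ltA ltB setT setT C r.+1 (add_move P a b) ->
    (X a \/ Y b) ->
    bf ltA ltB X Y C' r (add_move (fun u v => P u v /\ (X u \/ Y v)) a b).
  move=> hb Xab; apply: bf_sub (IH _ (add a b) hb) => u v.
  by case=> [[Puv Xuv]|[-> ->]]; split=> //; [left|right].
case: h => forth back; split=> [a Xa|b Yb].
  by case: (forth a I) => b hb; exists b; apply: lift => //; left.
by case: (back b I) => a ha; exists a; apply: lift => //; right.
Qed.

(* Across the two summands the order is decided by the markers [U] and [V]. *)
Lemma bf_sum (X1 X2 U : set A) (Y1 Y2 V : set B) (C P1 P2 : A -> B -> Prop)
    (r : nat) :
  (forall u v, C u v -> (U u <-> V v)) ->
  (forall u u', X1 u -> X2 u' -> [/\ u <> u', ~ ltA u' u & (ltA u u' <-> U u)]) ->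
  (forall v v', Y1 v -> Y2 v' -> [/\ v <> v', ~ ltB v' v & (ltB v v' <-> V v)]) ->
  bf ltA ltB X1 Y1 C r P1 -> bf ltA ltB X2 Y2 C r P2 ->
  (forall u v, P1 u v -> X1 u \/ Y1 v) -> (forall u v, P2 u v -> X2 u \/ Y2 v) ->
  bf ltA ltB (X1 `|` X2) (Y1 `|` Y2) C r (fun u v => P1 u v \/ P2 u v).
Proof.
move=> CUV ltX ltY; elim: r P1 P2 => [|r IH] P1 P2.
  move=> h1 h2 _ _ u v [Puv|Puv].
    have [Xu Yv Cuv hu] := h1 _ _ Puv; split=> //; [by left|by left|].
    move=> u' v' [/hu //|/h2[Xu' Yv' _ _]].
    have [ne1 _ ->] := ltX _ _ Xu Xu'; have [ne2 _ ->] := ltY _ _ Yv Yv'.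
    by split; [split|exact: CUV].
  have [Xu Yv Cuv hu] := h2 _ _ Puv; split=> //; [by right|by right|].
  move=> u' v' [/h1[Xu' Yv' _ _]|/hu //].
  have [ne1 nlt1 _] := ltX _ _ Xu' Xu; have [ne2 nlt2 _] := ltY _ _ Yv' Yv.
  by split; split=> // /esym.
move=> h1 h2 P1XY P2XY.
have [forth1 back1] := h1; have [forth2 back2] := h2.
(* A move in one summand leaves the other game a round ahead; [bfS] gives up that round. *)
have lift1 a b : (X1 a \/ Y1 b) -> bf ltA ltB X1 Y1 C r (add_move P1 a b) ->
    bf ltA ltB (X1 `|` X2) (Y1 `|` Y2) C r
      (add_move (fun u v => P1 u v \/ P2 u v) a b).
  move=> Xab h; apply: bf_sub (IH _ _ h (bfS P2XY h2) _ P2XY) => u v.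
    by case=> [[]|]; [left; left|right|left; right].
  by case=> [/P1XY //|[-> ->]].
have lift2 a b : (X2 a \/ Y2 b) -> bf ltA ltB X2 Y2 C r (add_move P2 a b) ->
    bf ltA ltB (X1 `|` X2) (Y1 `|` Y2) C r
      (add_move (fun u v => P1 u v \/ P2 u v) a b).
  move=> Xab h; apply: bf_sub (IH _ _ (bfS P1XY h1) h P1XY _) => u v.
    by case=> [[]|]; [left|right; left|right; right].
  by case=> [/P2XY //|[-> ->]].
split=> [a [Xa|Xa]|b [Yb|Yb]].
- by have [b hb] := forth1 a Xa; exists b; apply: lift1 => //; left.
- by have [b hb] := forth2 a Xa; exists b; apply: lift2 => //; left.
- by have [a ha] := back1 b Yb; exists a; apply: lift1 => //; right.
- by have [a ha] := back2 b Yb; exists a; apply: lift2 => //; right.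
Qed.

End Game.

Section GameTransfer.
Context {A B : Type} {ltA : A -> A -> Prop} {ltB : B -> B -> Prop}.

(** Duplicator relays each move through [B]: by [bf_last] the reply of one strategy is a legal move
    for the other. *)
Lemma bf_comp (D : Type) (ltD : D -> D -> Prop) (X : set A) (Y : set B)
    (Z : set D) (C1 P : A -> B -> Prop) (C2 Q : B -> D -> Prop)
    (C3 R : A -> D -> Prop) (r : nat) :
  (forall u v w, C1 u v -> C2 v w -> C3 u w) ->
  (forall u w, R u w -> exists2 v, P u v & Q v w) ->
  (forall u v, P u v -> X u \/ Y v) -> (forall v w, Q v w -> Y v \/ Z w) ->
  bf ltA ltB X Y C1 r P -> bf ltB ltD Y Z C2 r Q -> bf ltA ltD X Z C3 r R.
Proof.
move=> C123; elim: r P Q R => [|r IH] P Q R RPQ PXY QYZ.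
  move=> h1 h2 u w /RPQ[v /h1[Xu Yv C1uv hu] /h2[_ Zw C2vw hv]].
  split=> //; first exact: C123 C1uv C2vw.
  move=> u' w' /RPQ[v' Puv Qvw].
  by have [-> ->] := hu _ _ Puv; exact: hv.
have lift a b d : (X a \/ Y b) -> (Y b \/ Z d) ->
    bf ltA ltB X Y C1 r (add_move P a b) ->
    bf ltB ltD Y Z C2 r (add_move Q b d) ->
    bf ltA ltD X Z C3 r (add_move R a d).
  move=> Xab Ybd; apply: IH.
  - move=> u w [/RPQ[v Puv Qvw]|[-> ->]]; last by exists b; right.
    by exists v; left.
  - by move=> u v [/PXY //|[-> ->]].
  - by move=> v w [/QYZ //|[-> ->]].
case=> forth1 back1 [forth2 back2]; split=> [a Xa|d Zd].
  have [b hb] := forth1 a Xa.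
  have [_ Yb] := bf_last PXY (or_introl Xa) hb.
  have [d hd] := forth2 b Yb; exists d; apply: lift hb hd; first by left.
  by left.
have [b hb] := back2 d Zd.
have [Yb _] := bf_last QYZ (or_intror Zd) hb.
have [a ha] := back1 b Yb; exists a; apply: lift ha hb; first by right.
by left.
Qed.

(** Turns a game on suborders into a game on whole structures embedded onto them, such as
    restrictions. *)
Lemma bf_transfer (A' B' : Type) (ltA' : A' -> A' -> Prop)
    (ltB' : B' -> B' -> Prop) (f : A' -> A) (g : B' -> B)
    (X : set A) (Y : set B) (C P : A -> B -> Prop) (C' P' : A' -> B' -> Prop)
    (r : nat) :
  injective f -> injective g ->
  (forall u u', ltA' u u' <-> ltA (f u) (f u')) ->
  (forall v v', ltB' v v' <-> ltB (g v) (g v')) ->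
  X = range f -> Y = range g ->
  (forall u v, C (f u) (g v) -> C' u v) ->
  (forall u v, P' u v -> P (f u) (g v)) ->
  (forall u v, P u v -> X u \/ Y v) ->
  bf ltA ltB X Y C r P -> bf ltA' ltB' setT setT C' r P'.
Proof.
move=> finj ginj flt glt defX defY CC'; elim: r P P' => [|r IH] P P' PP' PXY.
  move=> h u v /PP'/h[_ _ Cuv hu]; split=> //; first exact: CC'.
  move=> u' v' /PP'/hu[eq lt]; rewrite flt glt; split=> //.
  by split=> [/(congr1 f)/eq/ginj|/(congr1 g)/eq/finj].
have lift a b : bf ltA ltB X Y C r (add_move P (f a) (g b)) ->
    bf ltA' ltB' setT setT C' r (add_move P' a b).
  apply: IH => [u v [/PP'|[-> ->]]|u v [/PXY //|[-> _]]]; [by left|by right|].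
  by left; rewrite defX; exists a.
case=> forth back; split=> [a _|b _].
  have Xa : X (f a) by rewrite defX; exists a.
  have [b hb] := forth _ Xa.
  have [|_ Yb _ _] := bf_iso _ hb (or_intror (conj erefl erefl)).
    by move=> u v [/PXY //|[-> _]]; left.
  by move: Yb hb; rewrite {1}defY => -[b' _ <-] hb; exists b'; apply: lift.
have Yb : Y (g b) by rewrite defY; exists b.
have [a ha] := back _ Yb.
have [Xa _] := bf_last PXY (or_intror Yb) ha.
by move: Xa ha; rewrite {1}defX => -[a' _ <-] ha; exists a'; apply: lift.
Qed.

End GameTransfer.

(** * Games and formulas *)

Definition same_prd (L : language) (A B : structure L) (a : A) (b : B) : Prop :=
  forall p : prd L, sprd p a <-> sprd p b.

Definition same_cst (L : language) (A B : structure L) (a : A) (b : B) : Prop :=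
  exists c : cst L, a = scst A c /\ b = scst B c.

Definition game (L : language) (A B : structure L) (r : nat)
    (P : A -> B -> Prop) : Prop :=
  bf (@slt L A) (@slt L B) setT setT (@same_prd L A B) r P.

Lemma game_forth (L : language) (A B : structure L) (r : nat)
    (P : A -> B -> Prop) (a : A) :
  game r.+1 P -> exists b, game r (add_move P a b).
Proof. exact: bf_forth. Qed.

Lemma game_back (L : language) (A B : structure L) (r : nat)
    (P : A -> B -> Prop) (b : B) :
  game r.+1 P -> exists a, game r (add_move P a b).
Proof. exact: bf_back. Qed.

Definition position (L : language) (A B : structure L) (k : nat)
    (e : k.-tuple A) (f : k.-tuple B) (a : A) (b : B) : Prop :=
  same_cst a b \/ exists i : 'I_k, a = tnth e i /\ b = tnth f i.

Lemma position_cons (L : language) (A B : structure L) (k : nat)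
    (e : k.-tuple A) (f : k.-tuple B) (a : A) (b : B) (u : A) (v : B) :
  position [tuple of a :: e] [tuple of b :: f] u v <->
  add_move (position e f) a b u v.
Proof.
split=> [[c|[i [-> ->]]]|[[c|[i [-> ->]]]|[-> ->]]].
- by left; left.
- case: (unliftP ord0 i) => [j|] ->; last by right; rewrite !tnth0.
  by left; right; exists j; rewrite !tnthS.
- by left.
- by right; exists (lift ord0 i); rewrite !tnthS.
- by right; exists ord0; rewrite !tnth0.
Qed.

Lemma position_eval (L : language) (A B : structure L) (k : nat)
    (e : k.-tuple A) (f : k.-tuple B) (t : term L k) :
  position e f (eval e t) (eval f t).
Proof. by case: t => [i|c]; [right; exists i|left; exists c]. Qed.

Lemma game_sat (L : language) (A B : structure L) (k : nat) (phi : formula L k)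
    (e : k.-tuple A) (f : k.-tuple B) (r : nat) :
  qrank phi <= r -> game r (position e f) -> (sat phi e <-> sat phi f).
Proof.
have iso j s (e' : j.-tuple A) (f' : j.-tuple B) : game s (position e' f') ->
    partial_iso (@slt L A) (@slt L B) setT setT (@same_prd L A B)
      (position e' f').
  by apply: bf_iso; left.
elim: k / phi r e f => [k|k t u|k t u|k p t|k phi IHphi psi IHpsi|k phi IH]
    /= r e f.
- by [].
- move=> _ /iso h; have [_ _ _ ht] := h _ _ (position_eval e f t).
  by have [-> _] := ht _ _ (position_eval e f u).
- move=> _ /iso h; have [_ _ _ ht] := h _ _ (position_eval e f t).
  by have [_ ->] := ht _ _ (position_eval e f u).
- by move=> _ /iso h; have [_ _ ht _] := h _ _ (position_eval e f t).
- rewrite geq_max => /andP[rphi rpsi] h.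
  have [p1 p2] := IHphi r e f rphi h; have [q1 q2] := IHpsi r e f rpsi h.
  by split; auto.
case: r => // r; rewrite ltnS => rphi [forth back].
have step a b : game r (add_move (position e f) a b) ->
    sat phi [tuple of a :: e] <-> sat phi [tuple of b :: f].
  move=> h; apply: (IH r) => //.
  by apply: bf_sub h => u v; rewrite position_cons.
split=> h a.
  by have [b /step <-] := back a I.
by have [b /step ->] := forth a I.
Qed.

(** * Characteristic formulas of tuples *)

Definition refute (L : language) (k : nat) (s : seq (formula L k)) :
    formula L k :=
  foldr (@Imp L k) (Bot L k) s.

Lemma sat_refute (L : language) (A : structure L) (k : nat) (I : eqType)
    (F : I -> formula L k) (s : seq I) (e : k.-tuple A) :
  sat (refute (map F s)) e <-> ~ (forall i, i \in s -> sat (F i) e).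
Proof.
elim: s => [|i s IH] /=; first by split=> // h; exfalso; apply: h.
rewrite /= IH; split=> [h all|h Fi all].
  apply: h => [|j js]; first by apply: all; rewrite mem_head.
  by apply: all; rewrite inE js orbT.
by apply: h => j; rewrite inE => /predU1P[-> //|/all].
Qed.

Lemma qrank_refute (L : language) (k r : nat) (I : Type)
    (F : I -> formula L k) (s : seq I) :
  (forall i, qrank (F i) <= r) -> qrank (refute (map F s)) <= r.
Proof. by move=> rF; elim: s => //= i s IH; rewrite geq_max rF. Qed.

Definition literal (L : language) (k : nat) (b : bool) (phi : formula L k) :=
  if b then phi else Imp phi (Bot L k).

Lemma qrank_literal (L : language) (k : nat) (b : bool) (phi : formula L k) :
  qrank (literal b phi) = qrank phi.
Proof. by case: b => //=; rewrite maxn0. Qed.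

Lemma sat_literal (L : language) (A : structure L) (k : nat) (b : bool)
    (phi : formula L k) (e : k.-tuple A) :
  sat (literal b phi) e <-> (sat phi e <-> b).
Proof.
by case: b => /=; split=> [h|[h h']]; [split|exact: h'|split=> // /h|move/h].
Qed.

Lemma mem_enumT (I : finType) (i : I) : i \in enum I.
Proof. by rewrite mem_enum. Qed.

(* Up to equivalence there are finitely many formulas of given rank in given
   free variables; the ones of rank [r.+1] listed here negate
   "some [x] satisfies exactly the listed formulas of rank [r] in [sigma]". *)
Lemma finite_formulas (L : language) (r k : nat) :
  exists (I : finType) (F : I -> formula L k),
    (forall i, qrank (F i) <= r) /\
    forall (A B : structure L) (e : k.-tuple A) (f : k.-tuple B),
      (forall i, sat (F i) e <-> sat (F i) f) -> game r (position e f).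
Proof.
elim: r k => [|r IH] k.
  pose tm (t : 'I_k + cst L) : term L k :=
    match t with inl i => Var L i | inr c => Cst k c end.
  pose tmT : finType := ('I_k + cst L)%type.
  exists (tmT * tmT * bool + prd L * tmT)%type.
  exists (fun i => match i with
    | inl (t, u, b) => if b then Eq (tm t) (tm u) else Lt (tm t) (tm u)
    | inr (p, t) => Prd p (tm t) end).
  split=> [[[[t u] []]|[p t]] //|A B e f agree].
  have pos u v : position e f u v ->
      exists t, u = eval e (tm t) /\ v = eval f (tm t).
    case=> [[c [-> ->]]|[i [-> ->]]]; first by exists (inr c).
    by exists (inl i).
  move=> u v /pos[t [-> ->]]; split=> // [p|u' v' /pos[t' [-> ->]]].
    exact: (agree (inr (p, t))).
  split; first exact: (agree (inl (t, t', true))).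
  exact: (agree (inl (t, t', false))).
have [I [F [rF agreeF]]] := IH k.+1.
pose lit (s : {set I}) i := literal (i \in s) (F i).
exists {set I}, (fun s => All (refute (map (lit s) (enum I)))).
split=> [s /=|A B e f agree].
  by rewrite ltnS; apply: qrank_refute => i; rewrite qrank_literal.
have witness (A1 B1 : structure L) (e1 : k.-tuple A1) (f1 : k.-tuple B1) (a : A1) :
    (forall s : {set I}, sat (All (refute (map (lit s) (enum I)))) f1 ->
       sat (All (refute (map (lit s) (enum I)))) e1) ->
    exists b : B1, forall i, sat (F i) [tuple of a :: e1] <-> sat (F i) [tuple of b :: f1].
  move=> agree1; apply: contrapT => nb.
  (* The formula for [s] denies that any element has the rank-[r] type of [a]. It fails at [e1]
     because of [a], and would hold at [f1] if no [b] matched [a]. *)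
  pose s := [set i | `[< sat (F i) [tuple of a :: e1] >]]%SET.
  have : ~ sat (All (refute (map (lit s) (enum I)))) e1.
    move=> /(_ a)/sat_refute; apply=> i _.
    by apply/sat_literal; rewrite inE; split=> /asboolP.
  apply; apply: agree1 => b; apply/sat_refute => sb; apply: nb; exists b => i.
  have /sat_literal -> := sb i (mem_enumT i).
  by rewrite inE; split=> /asboolP.
split=> [a _|b _].
  have [b hb] := witness _ _ e f a (fun s => proj2 (agree s)).
  by exists b; apply: bf_sub (agreeF _ _ _ _ hb) => u v; rewrite position_cons.
have [a ha] := witness _ _ f e b (fun s => proj1 (agree s)).
exists a; apply: bf_sub (agreeF _ _ [tuple of a :: e] [tuple of b :: f] _).
  by move=> u v h; apply/position_cons.
by move=> i; rewrite ha.
Qed.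

(** The conjunction of the literals true at [e], written as a negated [refute]. Focality speaks of
    one formula at a time, so a game type has to be captured by a single formula. *)
Lemma hintikka (L : language) (A : structure L) (r k : nat) (e : k.-tuple A) :
  exists phi : formula L k, [/\ qrank phi <= r, sat phi e &
    forall (B : structure L) (f : k.-tuple B), sat phi f ->
      game r (position e f)].
Proof.
have [I [F [rF agreeF]]] := finite_formulas L r k.
pose lit i := literal `[< sat (F i) e >] (F i).
exists (Imp (refute (map lit (enum I))) (Bot L k)); split=> /=.
- by rewrite maxn0; apply: qrank_refute => i; rewrite qrank_literal.
- by move/sat_refute; apply=> i _; apply/sat_literal; split=> /asboolP.
move=> B f nf; apply: agreeF => i.
have {}nf : forall i, i \in enum I -> sat (lit i) f.
  by apply: contrapT => /sat_refute/nf.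
have /sat_literal -> := nf i (mem_enumT i).
by split=> /asboolP.
Qed.

Lemma equivn_game (L : language) (n : nat) (A B : structure L) :
  equivn n A B -> game n (@same_cst L A B).
Proof.
have [I [F [rF agreeF]]] := finite_formulas L n 0.
move=> eqv; apply: bf_sub (agreeF A B [tuple] [tuple] _) => [u v|i].
  by left.
exact: eqv.
Qed.

Lemma game_equivn (L : language) (n : nat) (A B : structure L) :
  game n (@same_cst L A B) -> equivn n A B.
Proof.
move=> h phi rphi; apply: game_sat rphi _; apply: bf_sub h => u v [//|[[]]] //.
Qed.

(** * Types of single nodes *)

Definition same (L : language) (A B : structure L) (r : nat) (a : A) (b : B) :
    Prop :=
  game r (add_move (@same_cst L A B) a b).

Lemma equivn_same (L : language) (n : nat) (A B : structure L) (a : A) (b : B) :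
  equivn n (expand_cst a) (expand_cst b) -> same n a b.
Proof.
move/equivn_game; rewrite /same /game; apply: (bf_transfer (f := id) (g := id)) => //.
- by rewrite image_id.
- by rewrite image_id.
- move=> u v [[c [-> ->]]|[-> ->]]; last by exists None.
  by exists (Some c).
- by left.
Qed.

Lemma same_refl (L : language) (A : structure L) (r : nat) (a : A) : same r a a.
Proof. by apply: bf_refl => // u v [[c [-> ->]]|[-> ->]]. Qed.

Lemma same_sym (L : language) (A B : structure L) (r : nat) (a : A) (b : B) :
  same r a b -> same r b a.
Proof.
apply: bf_sym => [u v h p|u v [[c [-> ->]]|[-> ->]]]; [by rewrite h| |by right].
by left; exists c.
Qed.

Lemma same_trans (L : language) (A B D : structure L) (r : nat)
    (a : A) (b : B) (d : D) :
  same r a b -> same r b d -> same r a d.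
Proof.
apply: bf_comp => [u v w h1 h2 p|u w|u v|u v]; first by rewrite h1 h2.
- case=> [[c [-> ->]]|[-> ->]]; last by exists b; right.
  by exists (scst B c); left; exists c.
- by left.
- by left.
Qed.

Lemma game_le (L : language) (A B : structure L) (r s : nat) (P : A -> B -> Prop) :
  r <= s -> game s P -> game r P.
Proof. by apply: bf_le; left. Qed.

Lemma same_le (L : language) (A B : structure L) (r s : nat) (a : A) (b : B) :
  r <= s -> same s a b -> same r a b.
Proof. exact: game_le. Qed.

(** * Cross sections *)

Lemma game_iso (L : language) (A B : structure L) (r : nat) (Q : A -> B -> Prop)
    (u u' : A) (v v' : B) :
  game r Q -> Q u v -> Q u' v' ->
  [/\ u = u' <-> v = v', slt u u' <-> slt v v' & same_prd u v].
Proof.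
move=> h Quv Quv'; have hQ := bf_iso (fun _ _ _ => or_introl I) h.
by have [_ _ uv /(_ _ _ Quv')[eq lt]] := hQ u v Quv.
Qed.

(* An open cross section without reference to its interval: in this form it is
   definable from its end points with one quantifier. *)
Definition cross (L : language) (T : structure L) (a b : T) : set T :=
  [set z | [/\ slt a z, ~ slt b z & ~ coforest b z]].

(** A failure of the second clause of [coforest] is witnessed by one predecessor, which Spoiler can
    play in the single round. *)
Lemma game_coforest (L : language) (A B : structure L) (Q : A -> B -> Prop)
    (x z : A) (y z' : B) :
  game 1 Q -> Q x y -> Q z z' -> (coforest x z <-> coforest y z').
Proof.
move=> h Qxy Qz; have [_ ltxz _] := game_iso h Qxy Qz.
case: h => forth back; rewrite /coforest /= ltxz.
split=> -[nlt below]; split=> // u ux.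
  have [t ht] := back u I.
  have add := or_intror (conj erefl erefl) : add_move Q t u t u.
  have [_ <- _] := game_iso (r := 0) ht add (or_introl Qz).
  apply: below; have [_ + _] := game_iso (r := 0) ht add (or_introl Qxy).
  by case=> _; apply.
have [t ht] := forth u I.
have add := or_intror (conj erefl erefl) : add_move Q u t u t.
have [_ -> _] := game_iso (r := 0) ht add (or_introl Qz).
apply: below; have [_ + _] := game_iso (r := 0) ht add (or_introl Qxy).
by case=> + _; apply.
Qed.

Lemma game_cross (L : language) (A B : structure L) (Q : A -> B -> Prop)
    (a1 a2 z : A) (b1 b2 z' : B) :
  game 1 Q -> Q a1 b1 -> Q a2 b2 -> Q z z' ->
  (cross a1 a2 z <-> cross b1 b2 z').
Proof.
move=> h Q1 Q2 Qz; have [_ lt1 _] := game_iso h Q1 Qz.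
have [_ lt2 _] := game_iso h Q2 Qz.
have cf := game_coforest h Q2 Qz.
by split=> -[]; [rewrite lt1 lt2 cf|rewrite -lt1 -lt2 -cf].
Qed.

(** The condition on intervals stands for the unary predicate by which the cross sections are
    expanded. *)
Definition cross_game (L : language) (A B : structure L) (r : nat)
    (a1 a2 : A) (b1 b2 : B) (P : A -> B -> Prop) : Prop :=
  bf (@slt L A) (@slt L B) (cross a1 a2) (cross b1 b2)
    (fun u v => same_prd u v /\ (interval a1 a2 u <-> interval b1 b2 v)) r P.

(* The disjunction makes the two sides retain the same constants. *)
Definition cross_cst (L : language) (A B : structure L)
    (a1 a2 : A) (b1 b2 : B) (u : A) (v : B) : Prop :=
  same_cst u v /\ (cross a1 a2 u \/ cross b1 b2 v).

(** Once both end points are in the position, one remaining round decides [cross] and the order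
    alone decides the interval, so [bf_relativize] applies. *)
Lemma cross_game_cut (L : language) (A B : structure L) (r : nat)
    (Q : A -> B -> Prop) (a1 a2 : A) (b1 b2 : B) :
  game r.+1 Q -> (forall u v, same_cst u v -> Q u v) -> Q a1 b1 -> Q a2 b2 ->
  cross_game r a1 a2 b1 b2 (cross_cst a1 a2 b1 b2).
Proof.
move=> h QK Q1 Q2.
pose P0 (u : A) (v : B) := (u = a1 /\ v = b1) \/ (u = a2 /\ v = b2).
apply: bf_sub (bf_relativize (P0 := P0) _ _ h).
- by move=> u v [/QK].
- move=> R P0R hR u v Ruv.
  have R1 : R a1 b1 by apply: P0R; left.
  have R2 : R a2 b2 by apply: P0R; right.
  split; first exact: game_cross hR R1 R2 Ruv.
  have [_ lt1 _] := game_iso hR R1 Ruv; have [_ lt2 prd] := game_iso hR Ruv R2.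
  by split=> //; split=> -[/lt1 ? /lt2 ?].
by move=> u v [[-> ->]|[-> ->]].
Qed.

(** The marker [u = x] is there because an open interval around [x] meets the co-forest of [x] only
    in [x]. *)
Lemma coforest_game (L : language) (A B : structure L) (r : nat) (x : A) (y : B) :
  same r.+1 x y ->
  bf (@slt L A) (@slt L B) (coforest x) (coforest y)
    (fun u v => same_prd u v /\ (u = x <-> v = y)) r
    (fun u v => add_move (@same_cst L A B) x y u v /\ (coforest x u \/ coforest y v)).
Proof.
apply: (bf_relativize (P0 := fun u v => u = x /\ v = y)) => [R P0R hR u v Ruv|].
  have Rxy : R x y by apply: P0R.
  split; first exact: game_coforest hR Rxy Ruv.
  by have [eq _ prd] := game_iso hR Ruv Rxy.
by move=> u v; right.
Qed.

(** * Cutting a cross section at a node *)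

Section Tree.
Context (L : language) (T : structure L) (hT : is_tree T).

Lemma tree_irr (x : T) : ~ slt x x.
Proof. by case: hT => _ + _ _ _; apply. Qed.

Lemma tree_trans (x y z : T) : slt x y -> slt y z -> slt x z.
Proof. by case: hT => _ _ + _ _; apply. Qed.

Lemma tree_lin (t x y : T) : sle x t -> sle y t -> Defs.comparable x y.
Proof. by case: hT => _ _ _ + _; apply. Qed.

Lemma tree_lt_lin (t x y : T) : slt x t -> slt y t -> Defs.comparable x y.
Proof. by move=> xt yt; apply: (@tree_lin t); left. Qed.

Lemma sle_slt_trans (x y z : T) : sle x y -> slt y z -> slt x z.
Proof. by case=> [|->] //; apply: tree_trans. Qed.

Lemma slt_sle_trans (x y z : T) : slt x y -> sle y z -> slt x z.
Proof. by move=> xy [|<-] //; apply: tree_trans. Qed.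

Lemma cross_section_cross (hw : well_founded_tree T) (a b : T) :
  slt a b ->
  cross_section a b = cross a b.
Proof.
move=> ab; apply/seteqP; split=> z.
  move=> [x [ax xb] [nxz below]]; split; first exact: below.
    by move=> bz; apply: nxz; apply: tree_trans bz.
  by move=> [_ /(_ x xb)].
move=> [az nbz nz].
(* The co-forest containing [z] is that of a minimal node below [b] but not below [z]. Some such
   node exists, since otherwise [z] would lie in the co-forest of [b]. *)
have [|x [xb nxz] xmin] := hw [set u | slt u b /\ ~ slt u z].
  apply: contrapT => no; apply: nz; split=> // u ub; apply: contrapT => nuz.
  by apply: no; exists u.
have cfx : coforest x z.
  split=> // u ux; apply: contrapT => nuz; apply: (xmin u) => //.
  by split=> //; apply: tree_trans xb.
exists x => //; split=> //.
by case: (tree_lt_lin ab xb) => [//|xa|ax]; case: nxz;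
  [apply: tree_trans az|rewrite -ax].
Qed.

Section Cut.
Context (a b x : T) (ax : slt a x) (xb : slt x b).

Lemma cross_cut :
  cross a b = cross a x `|` (coforest x `|` cross x b).
Proof.
apply/seteqP; split=> z.
  move=> [az nbz nz]; have [xz|nxz] := pselect (slt x z); first by right; right.
  by have [cfz|ncfz] := pselect (coforest x z); [right; left|left].
move=> [[az nxz ncf]|[[nxz below]|[xz nbz ncf]]].
- split=> // [bz|[_ /(_ x xb)] //].
  by apply: nxz; apply: tree_trans bz.
- split=> [|bz|[_ /(_ x xb)] //]; first exact: below.
  by apply: nxz; apply: tree_trans bz.
- by split=> //; apply: tree_trans xz.
Qed.

Lemma interval_crossl (z : T) :
  cross a x z -> (interval a b z <-> interval a x z).
Proof.
move=> [az nxz ncf]; split=> -[_]; last first.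
  by move=> zx; split=> //; apply: tree_trans xb.
move=> zb; split=> //; case: (tree_lt_lin xb zb) => [/nxz //|//|xz].
by case: ncf; rewrite -xz; split=> //; apply: tree_irr.
Qed.

Lemma interval_coforest (z : T) : coforest x z -> (interval a b z <-> z = x).
Proof.
move=> [nxz below]; split=> [[az zb]|-> //].
case: (tree_lt_lin xb zb) => [/nxz //|/below|//].
by move/tree_irr.
Qed.

Lemma interval_crossr (z : T) :
  cross x b z -> (interval a b z <-> interval x b z).
Proof.
move=> [xz _ _]; split=> -[_ zb]; split=> //.
exact: tree_trans xz.
Qed.

(** A node of the co-forest of [x] other than [x] is incomparable with every node above [x]; hence
    membership of the interval decides the order, as [bf_sum] requires. *)
Lemma coforest_cross_lt (u w : T) : coforest x u -> cross x b w ->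
  [/\ u <> w, ~ slt w u & (slt u w <-> interval a b u)].
Proof.
move=> cfu [xw _ _]; case: (cfu) => nxu below.
split=> [uw|wu|]; first by apply: nxu; rewrite uw.
  by apply: nxu; apply: tree_trans wu.
rewrite interval_coforest //; split=> [uw|-> //].
case: (tree_lt_lin xw uw) => [/nxu //|/below|//].
by move/tree_irr.
Qed.

Lemma cross_coforest_lt (u w : T) :
  cross a x u -> (coforest x `|` cross x b) w ->
  [/\ u <> w, ~ slt w u & (slt u w <-> interval a b u)].
Proof.
move=> cu hw; case: (cu) => au nxu ncf.
(* Everything on the right lies above all predecessors of [x], while [u] misses some predecessor
   [t]. If [u] is below [w], comparing it with [t] puts it below [x]. *)
have {}hw t : slt t x -> slt t w.
  by case: hw => [[_]|[xw _ _] /tree_trans]; apply.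
have [t tx ntu] : exists2 t, slt t x & ~ slt t u.
  apply: contrapT => no; apply: ncf; split=> // t tx; apply: contrapT => ntu.
  by apply: no; exists t.
split=> [uw|wu|]; first by apply: ntu; rewrite uw; apply: hw.
  by apply: ntu; apply: tree_trans wu; apply: hw.
rewrite interval_crossl //; split=> [uw|[_ /hw] //]; split=> //.
case: (tree_lt_lin uw (hw t tx)) => [ut|/ntu //|->] //.
exact: tree_trans tx.
Qed.

End Cut.
End Tree.

Lemma coforest_exists (L : language) (T : structure L) (hT : is_tree T)
    (hw : well_founded_tree T) (a b z : T) :
  slt a b -> cross a b z -> exists2 x, interval a b x & coforest x z.
Proof. by move=> ab; rewrite -cross_section_cross // => -[x]; exists x. Qed.

(** The reply is found in the co-forest of [y]. Of the rank [r.+2], one round pays for relativizing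
    to the co-forests and one for the move [z]; [bf_sum] then glues the three pieces. *)
Lemma cross_game_move (L : language) (A B : structure L) (hA : is_tree A)
    (hB : is_tree B) (r : nat) (a1 a2 x z : A) (b1 b2 y : B) :
  interval a1 a2 x -> interval b1 b2 y ->
  cross_game r a1 x b1 y (cross_cst a1 x b1 y) ->
  cross_game r x a2 y b2 (cross_cst x a2 y b2) ->
  same r.+2 x y -> coforest x z ->
  exists z', cross_game r a1 a2 b1 b2
    (add_move (cross_cst a1 a2 b1 b2) z z').
Proof.
move=> [ax xa] [by_ yb] gl gr /coforest_game g cfz.
have [z' gm] := bf_forth cfz g.
exists z'; rewrite /cross_game (cross_cut hA ax xa) (cross_cut hB by_ yb).
have P2X u v : add_move (fun u v => add_move (@same_cst L A B) x y u v /\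
    (coforest x u \/ coforest y v)) z z' u v -> coforest x u \/ coforest y v.
  by case=> [[]//|[-> ->]]; left.
have P3X u v : cross_cst x a2 y b2 u v -> cross x a2 u \/ cross y b2 v by case.
have P1X u v : cross_cst a1 x b1 y u v -> cross a1 x u \/ cross b1 y v by case.
pose C u v := same_prd u v /\ (interval a1 a2 u <-> interval b1 b2 v).
have gl' : bf (@slt L A) (@slt L B) (cross a1 x) (cross b1 y) C r
    (cross_cst a1 x b1 y).
  apply: bf_mono gl => // u v cu cv [prd int]; split=> //.
  by rewrite (interval_crossl hA xa cu) (interval_crossl hB yb cv).
have gr' : bf (@slt L A) (@slt L B) (cross x a2) (cross y b2) C r
    (cross_cst x a2 y b2).
  apply: bf_mono gr => // u v cu cv [prd int]; split=> //.
  by rewrite (interval_crossr hA ax cu) (interval_crossr hB by_ cv).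
have gm' : bf (@slt L A) (@slt L B) (coforest x) (coforest y) C r
    (add_move (fun u v => add_move (@same_cst L A B) x y u v /\
      (coforest x u \/ coforest y v)) z z').
  apply: bf_mono gm => // u v cu cv [prd int]; split=> //.
  by rewrite (interval_coforest hA ax xa cu) (interval_coforest hB by_ yb cv).
have CI u v : C u v -> (interval a1 a2 u <-> interval b1 b2 v) by case.
have g2 := bf_sum CI (coforest_cross_lt hA ax xa) (coforest_cross_lt hB by_ yb)
  gm' gr' P2X P3X.
have g3 := bf_sum CI (cross_coforest_lt hA xa) (cross_coforest_lt hB yb)
  gl' g2 P1X.
apply: bf_sub (g3 _) => u v.
  case=> [[K]|[-> ->]]; last by right; left; right.
  rewrite (cross_cut hA ax xa) (cross_cut hB by_ yb).
  case=> -[h|[h|h]].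
  - by left; split=> //; left.
  - by right; left; left; split; [left|left].
  - by right; right; split=> //; left.
  - by left; split=> //; right.
  - by right; left; left; split; [left|right].
  - by right; right; split=> //; right.
by case=> [/P2X|/P3X] []; [left; left|right; left|left; right|right; right].
Qed.

Lemma position2 (L : language) (A B : structure L) (a x : A) (b y : B)
    (u : A) (v : B) :
  position [tuple a; x] [tuple b; y] u v <->
  add_move (add_move (@same_cst L A B) a b) x y u v.
Proof.
split=> [[K|[i]]|[[K|[-> ->]]|[-> ->]]].
- by left; left.
- case: i => [[|[|//]] lt] [-> ->]; first by left; right.
  by right.
- by left.
- by right; exists ord0.
- by right; exists (lift ord0 ord0).
Qed.

(** Focality is applied to the characteristic formula of the pair [a], [x]: any [y'] satisfying it
    together with [b] answers [x] as well as [y] does. *)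
Lemma focal_move (L : language) (T S : structure L) (hS : focal S) (r : nat)
    (a x : T) (b y c : S) :
  sle b y -> sle b c -> game r (add_move (add_move (@same_cst L T S) a b) x y) ->
  exists y', [/\ sle b y', Defs.comparable y' c &
    game r (add_move (add_move (@same_cst L T S) a b) x y')].
Proof.
move=> by_ bc h; have [phi [rphi phix phiE]] := hintikka r [tuple a; x].
have [|y' [by' y'c phiy']] := hS b phi _ c bc.
  exists y => //; apply: (proj1 (game_sat rphi _) phix).
  by apply: bf_sub h => u v /position2.
exists y'; split=> //; apply: bf_sub (phiE _ _ phiy') => u v.
by move=> ?; apply/position2.
Qed.

(** * Blocks *)

Lemma cross_game_trans (L : language) (A B D : structure L) (r : nat)
    (a1 a2 : A) (b1 b2 : B) (d1 d2 : D) :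
  cross_game r a1 a2 b1 b2 (cross_cst a1 a2 b1 b2) ->
  cross_game r b1 b2 d1 d2 (cross_cst b1 b2 d1 d2) ->
  cross_game r a1 a2 d1 d2 (cross_cst a1 a2 d1 d2).
Proof.
move=> h1 h2.
have K1 u v : cross_cst a1 a2 b1 b2 u v -> cross a1 a2 u \/ cross b1 b2 v by case.
have K2 u v : cross_cst b1 b2 d1 d2 u v -> cross b1 b2 u \/ cross d1 d2 v by case.
have i1 := bf_iso K1 h1; have i2 := bf_iso K2 h2.
apply: (bf_comp _ _ K1 K2 h1 h2).
  move=> u v w [p1 i1'] [p2 i2']; split=> [p|]; first by rewrite p1.
  exact: iff_trans i2'.
move=> u w [[c [-> ->]] cu]; exists (scst B c).
  split; [by exists c|case: cu => [cu|cw]; [by left|right]].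
  have K : cross_cst b1 b2 d1 d2 (scst B c) (scst D c).
    by split; [exists c|right].
  by have [] := i2 _ _ K.
split; [by exists c|case: cu => [cu|cw]; [left|by right]].
have K : cross_cst a1 a2 b1 b2 (scst A c) (scst B c).
  by split; [exists c|left].
by have [] := i1 _ _ K.
Qed.

(** * Frames of blocks and the induction on the rank *)

Section Frames.
Context (L : language) (Q : structure L) (M : set Q).

(* Types are compared with those of the nodes in [M], which is the interval of
   the first tree throughout; this gives nodes of different trees, and lower
   ranks, a common palette. *)
Definition coloured (T : structure L) (r : nat) (a b : T) : Prop :=
  forall x, interval a b x -> exists2 q, M q & same r x q.

Definition frame (T : structure L) (r k : nat) (B : nat -> set T) (a b : T) :
    Prop :=
  [/\ forall i, i < k -> B i `<=` interval a b,
      forall i q, i < k -> M q -> exists2 t, B i t & same r t q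
    & forall i j s t, i < j -> j < k -> B i s -> B j t -> slt s t].

(** Each node of one interval is answered by a node of the same type in the other. This colours
    intervals that are not known to lie inside a coloured one. *)
Lemma coloured_game (A B : structure L) (r : nat) (P : A -> B -> Prop)
    (a1 a2 : A) (b1 b2 : B) :
  game r.+1 P -> (forall u v, same_cst u v -> P u v) -> P a1 b1 -> P a2 b2 ->
  coloured r a1 a2 -> coloured r b1 b2.
Proof.
move=> h PK P1 P2 col v [bv vb]; have [u hu] := game_back v h.
have new := or_intror (conj erefl erefl) : add_move P u v u v.
have [_ lt1 _] := game_iso hu (or_introl P1) new.
have [_ lt2 _] := game_iso hu new (or_introl P2).
have [|q Mq uq] := col u; first by split; [apply/lt1|apply/lt2].
exists q => //; apply: same_trans uq; apply: same_sym.
by apply: bf_sub hu => s t [/PK|]; [left|right].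
Qed.

Section FrameCut.
Context (T : structure L) (hT : is_tree T) (r : nat).

Lemma coloured_sub (r' : nat) (a b a' b' : T) :
  r' <= r -> sle a a' -> sle b' b -> coloured r a b -> coloured r' a' b'.
Proof.
move=> rr aa bb col x [ax xb]; have [|q Mq xq] := col x.
  by split; [apply: sle_slt_trans ax|apply: slt_sle_trans bb].
by exists q => //; apply: same_le xq.
Qed.

Lemma frame_le (r' k : nat) (B : nat -> set T) (a b : T) :
  r' <= r -> frame r k B a b -> frame r' k B a b.
Proof.
move=> rr [sub full ord]; split=> // i q ik Mq.
by have [t Bt tq] := full i q ik Mq; exists t => //; apply: same_le tq.
Qed.

Lemma frame_left (h k : nat) (B : nat -> set T) (a b x : T) :
  h <= k -> (forall i t, i < h -> B i t -> slt t x) ->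
  frame r k B a b -> frame r h B a x.
Proof.
move=> hk Bx [sub full ord]; split=> [i ih t Bt|i q ih|i j s t ij jh].
- by split; [have [] := sub i (leq_trans ih hk) t Bt|apply: Bx Bt].
- by apply: full; apply: leq_trans hk.
- by apply: ord ij _; apply: leq_trans hk.
Qed.

Lemma frame_right (h k : nat) (B : nat -> set T) (a b x : T) :
  (forall i t, i < h -> B (k + i) t -> slt x t) ->
  frame r (k + h) B a b -> frame r h (fun i => B (k + i)) x b.
Proof.
move=> Bx [sub full ord]; split=> [i ih t Bt|i q ih|i j s t ij jh].
- split; first exact: Bx Bt.
  by have [|_] := sub (k + i) _ t Bt; rewrite // ltn_add2l.
- by apply: full; rewrite ltn_add2l.
- by apply: ord; rewrite ltn_add2l.
Qed.

Lemma frame_mid (h : nat) (B : nat -> set T) (a b : T) (q : Q) :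
  frame r (h.+1 + h) B a b -> M q ->
  exists y, [/\ interval a b y, same r y q, frame r h B a y
    & frame r h (fun i => B (h.+1 + i)) y b].
Proof.
move=> fr Mq; have [sub full ord] := fr.
have hh : h < h.+1 + h by rewrite addSn ltnS leq_addr.
have [y By yq] := full h q hh Mq; exists y; split=> //.
- exact: sub By.
- apply: frame_left fr => [|i t ih Bt]; first exact: ltnW.
  exact: ord ih hh Bt By.
- apply: frame_right fr => i t ih Bt; apply: ord By Bt.
    by rewrite addSn ltnS leq_addr.
  by rewrite ltn_add2l.
Qed.

(** Let [x] be below [b]. If some [t] in the last [h] sets is not above [x], then each node of the
    first [h] sets, being below [t] and comparable with [x], is below [x]. *)
Lemma frame_cut (h : nat) (B : nat -> set T) (a b x : T) :
  slt a b -> slt a x -> Defs.comparable x b -> frame r (h.+1 + h) B a b ->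
  (slt x b /\ frame r h (fun i => B (h.+1 + i)) x b) \/ frame r h B a x.
Proof.
move=> ab ax xb fr; have [sub _ ord] := fr.
have hk : h <= h.+1 + h by rewrite addSn -addnS leq_addr.
have [xltb|nxb] := pselect (slt x b); last first.
  right; apply: frame_left fr => // i t ih Bt.
  have [_ tb] := sub i (leq_trans ih hk) t Bt.
  by case: xb => // [/(tree_trans hT tb)|->].
have [right_|nright] := pselect
    (forall i t, i < h -> B (h.+1 + i) t -> slt x t).
  by left; split=> //; apply: frame_right fr.
right; apply: frame_left fr => // i s ih Bs.
apply: contrapT => nsx; apply: nright => j t jh Bt.
have jk : h.+1 + j < h.+1 + h by rewrite ltn_add2l.
have st : slt s t.
  by apply: ord Bs Bt => //; rewrite addSn;
    apply: leq_trans ih _; rewrite -addnS leq_addr.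
have [_ sb] := sub i (leq_trans ih hk) s Bs.
by case: (tree_lt_lin hT xltb sb) => [xs|/nsx//|-> //]; apply: tree_trans st.
Qed.

(** Here [x] may fail to be above [a]; it is then at or below [a], and all the sets lie above it. *)
Lemma frame_cut_below (h : nat) (B : nat -> set T) (a b x : T) :
  slt a b -> slt x b -> frame r (h.+1 + h) B a b ->
  frame r h (fun i => B (h.+1 + i)) x b \/ (slt a x /\ frame r h B a x).
Proof.
move=> ab xb fr; have [sub _ _] := fr; have [ax|nax] := pselect (slt a x).
  have xb' : Defs.comparable x b by constructor 1.
  by have [[_]|] := frame_cut ab ax xb' fr; [left|right].
left; apply: (frame_right _ fr) => i t ih Bt.
have [|at_ _] := sub _ _ t Bt; first by rewrite ltn_add2l.
by case: (tree_lt_lin hT ab xb) => [/nax //|xa|<- //]; apply: tree_trans at_.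
Qed.

Lemma partition_frame (k : nat) (P : 'I_k -> set T) (a b : T) :
  trivIset setT P -> (forall i, subinterval (interval a b) (P i)) ->
  (forall i q, M q -> exists2 t, P i t & same r t q) ->
  exists B, frame r k B a b.
Proof.
move=> disj conv full.
(* With an empty palette the parts may be empty and have no representatives; a family of empty sets
   then serves. *)
have [[q0 Mq0]|noM] := pselect (exists q, M q); last first.
  exists (fun _ => set0); split=> // i q _ Mq.
  by case: noM; exists q.
have /choice[p Pp] i : exists t, P i t by have [t Pt _] := full i q0 Mq0; exists t.
have inI i t : P i t -> interval a b t by case: (conv i) => + _; apply.
have lin t u : interval a b t -> interval a b u -> Defs.comparable t u.
  by move=> [_ tb] [_ ub]; apply: tree_lt_lin tb ub.
have disjE i j t : P i t -> P j t -> i = j.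
  by move=> Pi Pj; apply: (disj i j I I); exists t.
(* Disjoint convex parts are ordered like their representatives: if [y] preceded [x], comparing
   [p i] with [y] would put [y] in [P i] or [p i] in [P j]. *)
have ltP i j x y : i <> j -> slt (p i) (p j) -> P i x -> P j y -> slt x y.
  move=> ij pij Pix Pjy.
  have [//|yx|xy] := lin x y (inI _ _ Pix) (inI _ _ Pjy); last first.
    by case: ij; apply: disjE Pix _; rewrite xy.
  have [_ convi] := conv i; have [_ convj] := conv j.
  have [piy|ypi|piy] := lin (p i) y (inI _ _ (Pp i)) (inI _ _ Pjy).
  - case: ij; apply: (disjE _ _ y _ Pjy); exact: convi (Pp i) Pix (inI _ _ Pjy) piy yx.
  - case: ij; apply: disjE (Pp i) _.
    exact: convj Pjy (Pp j) (inI _ _ (Pp i)) ypi pij.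
  - by case: ij; apply: disjE (Pp i) _; rewrite piy.
case: k P p {disj conv} full Pp inI disjE ltP => [|k] P p full Pp inI disjE ltP.
  by exists (fun _ => set0); split=> // i j s t _.
pose le i j := `[< i = j \/ slt (p i) (p j) >].
have le_trans : transitive le.
  move=> j i l /asboolP[-> //|ij] /asboolP[<-|jl]; apply/asboolP; right=> //.
  exact: tree_trans ij jl.
have le_total : total le.
  move=> i j; have [h|h|h] := lin _ _ (inI _ _ (Pp i)) (inI _ _ (Pp j)).
  - by apply/orP; left; apply/asboolP; right.
  - by apply/orP; right; apply/asboolP; right.
  - apply/orP; left; apply/asboolP; left; apply: (disjE i j (p i)) => //.
    by rewrite h.
pose s := sort le (enum 'I_k.+1).
have size_s : size s = k.+1 by rewrite size_sort size_enum_ord.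
exists (fun i => P (nth ord0 s i)); split=> [i _ t /inI //|i q _ /full //|].
move=> i j x y ij jk; have ik := ltn_trans ij jk.
apply: ltP.
  move/eqP; rewrite nth_uniq ?size_s ?sort_uniq ?enum_uniq //.
  by rewrite (ltn_eqF ij).
have /asboolP[/eqP|//] : le (nth ord0 s i) (nth ord0 s j).
  apply: sorted_ltn_nth => //; rewrite ?inE ?size_s //.
  exact: sort_sorted.
rewrite nth_uniq ?size_s ?sort_uniq ?enum_uniq //.
by rewrite (ltn_eqF ij).
Qed.

End FrameCut.

(** Both trees are quantified here, because the induction also compares two intervals of one tree,
    and moves of Spoiler in [S] exchange the trees. *)
Definition framed_cross (n : nat) : Prop :=
  forall (T S : structure L) (B : nat -> set T) (B' : nat -> set S)
    (a1 a2 : T) (b1 b2 : S),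
  [/\ is_tree T, focal T & well_founded_tree T] ->
  [/\ is_tree S, focal S & well_founded_tree S] ->
  slt a1 a2 -> slt b1 b2 -> same n.+2 a1 b1 -> same n.+2 a2 b2 ->
  coloured n.+1 a1 a2 -> coloured n.+1 b1 b2 ->
  frame n.+1 (2 ^ n - 1) B a1 a2 -> frame n.+1 (2 ^ n - 1) B' b1 b2 ->
  cross_game n a1 a2 b1 b2 (cross_cst a1 a2 b1 b2).

(** One of the [n.+3] rounds at an end point is spent on [x]; the [n.+2] left give the type of the
    reply and the hypotheses of the induction at rank [n]. *)
Lemma framed_cross_choice (n : nat) (T S : structure L)
    (B : nat -> set T) (B' : nat -> set S) (a1 a2 x : T) (b1 b2 : S) :
  framed_cross n ->
  [/\ is_tree T, focal T & well_founded_tree T] ->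
  [/\ is_tree S, focal S & well_founded_tree S] ->
  slt a1 a2 -> slt b1 b2 -> same n.+3 a1 b1 -> same n.+3 a2 b2 ->
  coloured n.+2 a1 a2 -> coloured n.+2 b1 b2 ->
  frame n.+2 (2 ^ n.+1 - 1) B a1 a2 -> frame n.+2 (2 ^ n.+1 - 1) B' b1 b2 ->
  interval a1 a2 x ->
  exists y, [/\ interval b1 b2 y,
    cross_game n a1 x b1 y (cross_cst a1 x b1 y),
    cross_game n x a2 y b2 (cross_cst x a2 y b2) & same n.+2 x y].
Proof.
move=> IH hT hS ha hb h1 h2 colT colS.
have [tT _ _] := hT; have [tS fS _] := hS.
(* With [h = 2 ^ n - 1] the number is [2h + 1]: a middle set and [h] sets on either side. *)
have -> : 2 ^ n.+1 - 1 = (2 ^ n - 1).+1 + (2 ^ n - 1).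
  rewrite expnS mul2n -addnn; case: (2 ^ n) (expn_gt0 2 n) => // p _.
  by rewrite !subn1 /= addnS.
move=> frT frS xI; have [ax xa] := xI.
have [q Mq xq] := colT x xI.
have le1 : n.+1 <= n.+2 by []. have le2 : n.+2 <= n.+3 by [].
have s1 := same_le le2 h1; have s2 := same_le le2 h2.
(* At least one side of [x] keeps [h] sets and is open to induction; the other is first handled by
   the game from its end point. *)
have [fr|fl] : frame n.+2 (2 ^ n - 1) (fun i => B ((2 ^ n - 1).+1 + i)) x a2 \/
    frame n.+2 (2 ^ n - 1) B a1 x.
- by have [|[_]] := frame_cut_below tT ha xa frT; [left|right].
- have gamer C y : interval b1 b2 y -> same n.+2 x y ->
      frame n.+2 (2 ^ n - 1) C y b2 -> cross_game n x a2 y b2 (cross_cst x a2 y b2).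
    move=> [b1y yb2] xy frC; apply: (IH T S _ C) => //; last exact: frame_le frC.
    + by apply: coloured_sub colT => //; [left|right].
    + by apply: coloured_sub colS => //; [left|right].
    + exact: frame_le fr.
  (* The reply [y0] is above [b1] but may be incomparable with [b2]; focality replaces it by [y1],
     comparable with [b2]. *)
  have [y0 g0] := game_forth x (h1 : game n.+3 _).
  have newx y : add_move (add_move (@same_cst L T S) a1 b1) x y x y by right.
  have old y : add_move (add_move (@same_cst L T S) a1 b1) x y a1 b1.
    by left; right.
  have oldK y u v : same_cst u v ->
      add_move (add_move (@same_cst L T S) a1 b1) x y u v by left; left.
  have [_ [/(_ ax) b1y0 _] _] := game_iso g0 (old y0) (newx y0).
  have [y1 [_ y1b2 g1]] := focal_move fS (or_introl b1y0) (or_introl hb) g0.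
  have [_ [/(_ ax) b1y1 _] _] := game_iso g1 (old y1) (newx y1).
  have xy1 : same n.+2 x y1.
    by apply: bf_sub g1 => u v [/oldK//|]; right.
  have gl1 := cross_game_cut (game_le le1 g1) (oldK y1) (old y1) (newx y1).
  have [[y1b2' fry1]|fly1] := frame_cut tS hb b1y1 y1b2 frS.
    exists y1; split=> //; exact: gamer fry1.
  (* Otherwise [h] sets lie below [y1]. A node [y] of the same type is taken from the middle set,
     and induction inside [S] compares the cross sections over [(b1, y1)] and [(b1, y)]. *)
  have [y [yI yq fly fry]] := frame_mid frS Mq; have [b1y yb2] := yI.
  have xy : same n.+2 x y := same_trans xq (same_sym yq).
  exists y; split=> //; last exact: gamer fry.
  apply: cross_game_trans gl1 _.
  apply: (IH S S B' B') => //.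
  + exact: same_refl.
  + exact: same_trans (same_sym xy1) xy.
  (* Since [y1] need not be below [b2], the colouring of [(b1, y1)] is carried over from
     [(a1, x)]. *)
  + apply: (coloured_game g1 (oldK y1) (old y1) (newx y1)).
    by apply: coloured_sub colT => //; [right|left].
  + by apply: coloured_sub colS => //; [right|left].
  + exact: frame_le fly1.
  + exact: frame_le fly.
have gamel C y : interval b1 b2 y -> same n.+2 x y ->
    frame n.+2 (2 ^ n - 1) C b1 y -> cross_game n a1 x b1 y (cross_cst a1 x b1 y).
  move=> [b1y yb2] xy frC; apply: (IH T S B C) => //; last exact: frame_le frC.
  - by apply: coloured_sub colT => //; [right|left].
  - by apply: coloured_sub colS => //; [right|left].
  - exact: frame_le fl.
(* On this side linearity below [b2] takes the place of focality: the reply is comparable with [b1],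
   though possibly not above it. *)
have [y1 g1] := game_forth x (h2 : game n.+3 _).
have newx : add_move (add_move (@same_cst L T S) a2 b2) x y1 x y1 by right.
have old : add_move (add_move (@same_cst L T S) a2 b2) x y1 a2 b2.
  by left; right.
have oldK u v : same_cst u v ->
    add_move (add_move (@same_cst L T S) a2 b2) x y1 u v by left; left.
have [_ [/(_ xa) y1b2 _] _] := game_iso g1 newx old.
have xy1 : same n.+2 x y1.
  by apply: bf_sub g1 => u v [/oldK//|]; right.
have gr1 := cross_game_cut (game_le le1 g1) oldK newx old.
have [fry1|[b1y1 fly1]] := frame_cut_below tS hb y1b2 frS; last first.
  exists y1; split=> //; exact: gamel fly1.
have [y [yI yq fly fry]] := frame_mid frS Mq; have [b1y yb2] := yI.
have xy : same n.+2 x y := same_trans xq (same_sym yq).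
exists y; split=> //; first exact: gamel fly.
apply: cross_game_trans gr1 _.
apply: (IH S S _ _) => //.
- exact: same_trans (same_sym xy1) xy.
- exact: same_refl.
- apply: (coloured_game g1 oldK newx old).
  by apply: coloured_sub colT => //; [left|right].
- by apply: coloured_sub colS => //; [left|right].
- exact: frame_le fry1.
- exact: frame_le fry.
Qed.

Lemma framed_cross_holds (n : nat) : framed_cross n.
Proof.
elim: n => [|n IH] T S B B' a1 a2 b1 b2 hT hS ha hb h1 h2 colT colS frT frS.
  (* With no rounds to play, only constants are in the position, and their place relative to the end
     points settles everything. *)
  have le2 : 1 <= 2 by [].
  have K1 u v : same_cst u v -> add_move (@same_cst L T S) a1 b1 u v by left.
  have K2 u v : same_cst u v -> add_move (@same_cst L T S) a2 b2 u v by left.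
  have new1 : add_move (@same_cst L T S) a1 b1 a1 b1 by right.
  have new2 : add_move (@same_cst L T S) a2 b2 a2 b2 by right.
  have pos u v : same_cst u v -> [/\ same_prd u v,
      (cross a1 a2 u <-> cross b1 b2 v) &
      (interval a1 a2 u <-> interval b1 b2 v)].
    move=> Kuv; have [_ lta1 prd] := game_iso h1 new1 (K1 _ _ Kuv).
    have [_ lta2 _] := game_iso h2 new2 (K2 _ _ Kuv).
    have [_ lt2a uv] := game_iso h2 (K2 _ _ Kuv) new2.
    have cf := game_coforest (game_le le2 h2) new2 (K2 _ _ Kuv).
    split=> //; last by split=> -[/lta1 ? /lt2a ?].
    by split=> -[]; [rewrite lta1 lta2 cf|rewrite -lta1 -lta2 -cf].
  move=> u v [Kuv cuv]; have [prd cr int] := pos u v Kuv.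
  have cu : cross a1 a2 u by case: cuv => // /cr.
  split=> //; first exact/cr.
  move=> u' v' [Kuv' _].
  by have [] := game_iso h1 (K1 _ _ Kuv) (K1 _ _ Kuv').
have [tT _ wT] := hT; have [tS _ wS] := hS.
split=> [z cz|z cz].
  have [x xI cfx] := coforest_exists tT wT ha cz.
  have [y [yI gl gr xy]] :=
    framed_cross_choice IH hT hS ha hb h1 h2 colT colS frT frS xI.
  exact: cross_game_move gl gr xy cfx.
(* For a move in [S] the trees are exchanged, and [bf_sym] turns the resulting strategy round. *)
have [x xI cfx] := coforest_exists tS wS hb cz.
have [y [yI gl gr xy]] := framed_cross_choice IH hS hT hb ha
  (same_sym h1) (same_sym h2) colS colT frS frT xI.
have [z' gz] := cross_game_move tS tT xI yI gl gr xy cfx.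
exists z'; apply: bf_sym gz => [u v [prd int]|u v].
  by split; [move=> p; rewrite prd|rewrite int].
case=> [[[c [-> ->]] cuv]|[-> ->]]; last by right.
by left; split; [exists c|case: cuv; [right|left]].
Qed.

End Frames.

(** * From block partitions to the theorem *)

Lemma sval_inj (A : Type) (P : A -> Prop) : injective (@sval A P).
Proof.
by move=> [u pu] [v pv] /= uv; subst v; rewrite (Prop_irrelevance pu pv).
Qed.

(** The formula true at [t] has its number in [M], so it holds somewhere in [Y]. As each node
    satisfies exactly one formula of the list, sharing one means sharing the type. *)
Lemma block_same (n : nat) (L : language) (m : nat) (tau : 'I_m -> formula L 1)
    (T S : structure L) (M : set nat) (X : set T) (Y : set S) (t : T) :
  characteristic n tau -> block tau M X -> block tau M Y -> X t ->
  exists2 s, Y s & same n s t.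
Proof.
move=> [_ ex1 agree] bX bY Xt; have [i [ti iuniq]] := ex1 T t.
have : M i.+1 by rewrite -bX; exists i => //; exists t.
rewrite -bY => -[j [s Ys tj] [/val_inj ji]]; rewrite ji in tj.
exists s => //; apply/same_sym/equivn_same/agree => k.
have [l [_ luniq]] := ex1 S s; have il := luniq _ tj.
by split=> h; [rewrite -(iuniq _ h)|rewrite -(luniq _ h) il].
Qed.

Theorem lemma5p1 (n : nat) (L : language)
  (m : nat) (tau : 'I_m -> formula L 1) (htau : characteristic n.+1 tau)
  (T S : structure L)
  (hT : is_tree T) (hTf : focal T) (hTw : well_founded_tree T)
  (hS : is_tree S) (hSf : focal S) (hSw : well_founded_tree S)
  (a1 a2 : T) (b1 b2 : S)
  (ha : slt a1 a2) (hb : slt b1 b2)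
  (h1 : equivn n.+2 (expand_cst a1) (expand_cst b1))
  (h2 : equivn n.+2 (expand_cst a2) (expand_cst b2))
  (hM : exists M : set nat,
    [/\ M `<=` [set i | 0 < i],
        block_partition tau M (2 ^ n - 1) (interval a1 a2)
      & block_partition tau M (2 ^ n - 1) (interval b1 b2)]) :
  exists (D : {set cst L})
         (hDT : retained (cross_section a1 a2) D)
         (hDS : retained (cross_section b1 b2) D),
    equivn n
      (expand_prd (A := restriction hDT) [set x | interval a1 a2 (sval x)])
      (expand_prd (A := restriction hDS) [set x | interval b1 b2 (sval x)]).
Proof.
have s1 := equivn_same h1; have s2 := equivn_same h2.
have [M [_ [P [PU Pdisj Pconv Pblock]] [P' [PU' Pdisj' Pconv' Pblock']]]] := hM.
(* The palette is the interval [(a1, a2)] itself. Every part of either partition realises all of it,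
   the parts being blocks for the same [M]. *)
have blockT q : interval a1 a2 q -> exists i, P i q.
  by rewrite -PU => -[i _]; exists i.
have [B frT] : exists B, frame (interval a1 a2) n.+1 (2 ^ n - 1) B a1 a2.
  apply: partition_frame Pdisj Pconv _ => // i q /blockT[j].
  exact: block_same htau (Pblock j) (Pblock i).
have [B' frS] : exists B', frame (interval a1 a2) n.+1 (2 ^ n - 1) B' b1 b2.
  apply: partition_frame Pdisj' Pconv' _ => // i q /blockT[j].
  exact: block_same htau (Pblock j) (Pblock' i).
have colT : coloured (interval a1 a2) n.+1 a1 a2.
  by move=> q qI; exists q => //; apply: same_refl.
have colS : coloured (interval a1 a2) n.+1 b1 b2.
  move=> s; rewrite -PU' => -[i _ Ps].
  have [q Pq qs] := block_same htau (Pblock' i) (Pblock i) Ps.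
  by exists q; [rewrite -PU; exists i|apply: same_sym].
have g := framed_cross_holds (And3 hT hTf hTw) (And3 hS hSf hSw)
  ha hb s1 s2 colT colS frT frS.
have XY u v : cross_cst a1 a2 b1 b2 u v -> cross a1 a2 u \/ cross b1 b2 v by case.
have iso := bf_iso XY g.
(* [D] is read off from [T]; since [cross_cst] is a partial isomorphism between the cross sections,
   [S] retains the same constants. *)
pose D := [set c | `[< cross a1 a2 (scst T c) >]]%SET.
have hDT : retained (cross_section a1 a2) D.
  by move=> c; rewrite cross_section_cross // inE; split=> /asboolP.
have hDS : retained (cross_section b1 b2) D.
  move=> c; rewrite cross_section_cross // inE; split=> [/asboolP|] h.
    have K : cross_cst a1 a2 b1 b2 (scst T c) (scst S c).
      by split; [exists c|left].
    by have [] := iso _ _ K.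
  have K : cross_cst a1 a2 b1 b2 (scst T c) (scst S c).
    by split; [exists c|right].
  by apply/asboolP; have [] := iso _ _ K.
exists D, hDT, hDS; apply: game_equivn.
(* The restrictions embed by [sval] onto the cross sections, and the condition on intervals becomes
   agreement on the added predicate [None]. *)
apply: (bf_transfer (f := sval) (g := sval)) XY g => //.
- exact: sval_inj.
- exact: sval_inj.
- rewrite -cross_section_cross //; apply/seteqP; split=> [u cu|_ [u _ <-]].
    by exists (exist _ u cu).
  exact: svalP.
- rewrite -cross_section_cross //; apply/seteqP; split=> [u cu|_ [u _ <-]].
    by exists (exist _ u cu).
  exact: svalP.
- by move=> u v [prd int] [p|]; [exact: prd|exact: int].
move=> u v [[c cD] [-> ->]] /=; split; first by exists c.
by left; rewrite -cross_section_cross //; apply/hDT.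
Qed.
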